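(* Let $E$ be a Banach lattice with a basis $(e_i)$. Then the map that sends $\sum_{i=1}^\infty u_i\,e_i\otimes e_i$ in $E\otimes_{|\pi|}E$ to $\sum_{i=1}^\infty u_i\odot e_i$ in $\overline{E_{(2)}}$ (the latter series being taken with respect to the operations of $\overline{E_{(2)}}$) is a surjective lattice isometry between $(E\otimes_{|\pi|}E)/I_{\rm oc}$ and $\overline{E_{(2)}}$.
   Context: All Banach lattices are real. A Banach lattice with a basis $(e_i)$ is a Banach lattice $E$ with a Schauder basis $(e_i)$ that defines the order: $x=\sum_{i=1}^\infty x_ie_i$ satisfies $x\ge0$ if and only if $x_i\ge0$ for all $i$. (Such a basis is automatically $1$-unconditional.) A lattice isometry is a linear lattice homomorphism that preserves the norm. 2-concavification: for $t\in\mathbb R$ and $p>0$, $t^p$ means $|t|^p\operatorname{sign}t$. On $E$ define new operations $x\oplus y=(x^2+y^2)^{1/2}$ and $\alpha\odot x=\alpha^{1/2}x$ ($\alpha\in\mathbb R$), with the signed-power convention; the expression $(x^2+y^2)^{1/2}$ is computed coordinatewise with respect to $(e_i)$ (it agrees with the continuous homogeneous functional calculus of $E$). With these operations and the original order $E$ is a vector lattice, and $\|x\|_{(2)}=\inf\{\sum_{i=1}^n\|v_i\|^2 : |x|\le v_1\oplus\dots\oplus v_n,\ v_i\ge 0\}$ is a lattice seminorm; the resulting space is $E_{(2)}$. For $E$ with a basis this seminorm is a norm, and $\overline{E_{(2)}}$ denotes the completion of $E_{(2)}$, a Banach lattice. Fremlin tensor product: for Banach lattices $E,F$, the norm of $u$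 in the algebraic tensor product $E\otimes F$ is $\|u\|_{|\pi|}=\sup\|\hat\varphi(u)\|$, where the supremum is over all Banach lattices $G$ and all positive bilinear maps $\varphi\colon E\times F\to G$ (i.e. $\varphi(x,y)\ge 0$ whenever $x,y\ge 0$) with $\|\varphi\|=\sup\{\|\varphi(x,y)\|:\|x\|\le1,\|y\|\le1\}\le 1$, and $\hat\varphi$ is the induced linear map on $E\otimes F$. The completion of $E\otimes F$ in this norm is a Banach lattice (its positive cone is the closure of the convex cone generated by $x\otimes y$ with $x,y\ge0$), denoted $E\otimes_{|\pi|}F$. It has the universal property that continuous positive bilinear maps $\varphi\colon E\times F\to G$ correspond one-to-one and norm-preservingly to positive operators $T\colon E\otimes_{|\pi|}F\to G$ with $T(x\otimes y)=\varphi(x,y)$; $T$ is a lattice homomorphism if and only if $|\varphi(x,y)|=\varphi(|x|,|y|)$ for all $x,y$. $I_{\rm oc}$ denotes the norm closed order ideal of $E\otimes_{|\pi|}E$ generated by $\{x\otimes y : x,y\in E,\ x\perp y\}$. When $E$ has a basis $(e_i)$, $(e_i\otimes e_j)_{i,j}$ is a disjoint $1$-unconditional basis of $E\otimes_{|\pi|}E$, $I_{\rm oc}$ is the closed span of $\{e_i\otimes e_j: i\ne j\}$, and the quotient $(E\otimes_{|\pi|}E)/I_{\rm oc}$ is identified with the complementary band, the closed span of $\{e_i\otimes e_i: i\in\mathbb N\}$ in $E\otimes_{|\pi|}E$ (each coset corresponding to its unique representative in this closed span). *)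

(* Defs.v *)
From HB Require Import structures.
From mathcomp Require Import all_boot all_order all_algebra.
From mathcomp Require Import all_classical all_reals all_analysis.
Set Implicit Arguments.
Unset Strict Implicit.
Unset Printing Implicit Defensive.
Import Order.TTheory GRing.Theory Num.Theory.
Import numFieldNormedType.Exports.
Local Open Scope classical_set_scope.
Local Open Scope ring_scope.

(* The vector order is carried by this mixin rather than by an
   Order.Lattice structure: a join of Order.Lattice (even of Order.Preorder)
   with normed modules is rejected by Hierarchy Builder, because numDomainType
   already inherits from both sides.  `|x| is the norm, vabs x the modulus. *)
HB.mixin Record CompleteNormedModule_isBanachLattice (R : realType) E
    & CompleteNormedModule R E := {
  vle : rel E ;
  vjoin : E -> E -> E ;
  vmeet : E -> E -> E ;
  vle_refl : reflexive vle ;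
  vle_anti : antisymmetric vle ;
  vle_trans : transitive vle ;
  vle_joinP : forall x y z : E, vle (vjoin x y) z = vle x z && vle y z ;
  vle_meetP : forall x y z : E, vle z (vmeet x y) = vle z x && vle z y ;
  vle_add2r : forall z x y : E, vle x y -> vle (x + z) (y + z) ;
  vle_scale : forall (a : R) (x : E), 0 <= a -> vle 0 x -> vle 0 (a *: x) ;
  vnorm_le : forall x y : E,
    vle (vjoin x (- x)) (vjoin y (- y)) -> `|x| <= `|y| }.

#[short(type="banachLatticeType")]
HB.structure Definition BanachLattice (R : realType) :=
  {E of CompleteNormedModule R E
   & CompleteNormedModule_isBanachLattice R E}.

Section BanachLatticeNotions.
Variable R : realType.

Definition vabs (E : banachLatticeType R) (x : E) : E := vjoin x (- x).

Definition vdisjoint (E : banachLatticeType R) (x y : E) : Prop :=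
  vmeet (vabs x) (vabs y) = 0.

Definition lattice_morphism (E F : banachLatticeType R) (f : E -> F) : Prop :=
  {morph f : x y / vjoin x y} /\ {morph f : x y / vmeet x y}.

Definition lattice_isometry (E F : banachLatticeType R)
    (f : {linear E -> F}) : Prop :=
  lattice_morphism f /\ forall x, `|f x| = `|x|.

Definition order_ideal (E : banachLatticeType R) (I : set E) : Prop :=
  [/\ I 0, forall x y, I x -> I y -> I (x + y),
      forall (a : R) x, I x -> I (a *: x)
    & forall x y, I y -> vle (vabs x) (vabs y) -> I x].

Definition closed_ideal_generated (E : banachLatticeType R) (S : set E) :
    set E :=
  smallest [set I : set E | order_ideal I /\ closed I] S.

(* q : E -> Q is the canonical surjection of E onto the quotient Banach
   lattice of E by the closed ideal I. *)
Definition is_lattice_quotient (E Q : banachLatticeType R) (I : set E)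
    (q : {linear E -> Q}) : Prop :=
  [/\ range q = [set: Q], forall x, q x = 0 <-> I x, lattice_morphism q
    & forall x, `|q x| = inf [set `|x + v| | v in I]].

Definition lattice_basis (E : banachLatticeType R) (e : nat -> E) : Prop :=
  (forall x : E, exists! a : nat -> R,
     series (fun i => a i *: e i) @ \oo --> x) /\
  (forall (a : nat -> R) (x : E), series (fun i => a i *: e i) @ \oo --> x ->
     vle 0 x <-> forall i, 0 <= a i).

Definition coord (E : banachLatticeType R) (e : nat -> E) (x : E) : nat -> R :=
  xget (fun=> 0) [set a : nat -> R | series (fun i => a i *: e i) @ \oo --> x].

Definition positive_bilinear (E F G : banachLatticeType R)
    (phi : {bilinear E -> F -> G}) : Prop :=
  forall x y, vle 0 x -> vle 0 y -> vle 0 (phi x y).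

Definition bilinear_contraction (E F G : banachLatticeType R)
    (phi : {bilinear E -> F -> G}) : Prop :=
  forall x y, `|x| <= 1 -> `|y| <= 1 -> `|phi x y| <= 1.

(* The finite sequence s = [:: (x_1, y_1); ..; (x_n, y_n)] stands for the
   element u = \sum_k x_k (x) y_k of the algebraic tensor product of E and F;
   tsum phi s is then the value at u of the linear map induced by phi. *)
Definition tsum (E F G : banachLatticeType R) (phi : {bilinear E -> F -> G})
    (s : seq (E * F)) : G :=
  \sum_(p <- s) phi p.1 p.2.

Definition fremlin_norm (E F : banachLatticeType R) (s : seq (E * F)) : R :=
  sup [set r : R | exists (G : banachLatticeType R)
                     (phi : {bilinear E -> F -> G}),
         [/\ positive_bilinear phi, bilinear_contraction phi
           & r = `|tsum phi s|]].

(* The complete space T, with the canonical map (x, y) |-> x (x) y, is the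
   completion of the algebraic tensor product of E and F for fremlin_norm,
   ordered by the closure of the cone generated by the x (x) y, x, y >= 0. *)
Definition is_fremlin_tensor (E F T : banachLatticeType R)
    (tens : {bilinear E -> F -> T}) : Prop :=
  [/\ forall s : seq (E * F), `|tsum tens s| = fremlin_norm s,
      dense (range (tsum tens))
    & [set t : T | vle 0 t] =
      closure [set tsum tens s | s in
        [set s : seq (E * F) |
          forall p, p \in s -> vle 0 p.1 /\ vle 0 p.2]]].

Definition I_oc (E T : banachLatticeType R) (tens : {bilinear E -> E -> T}) :
    set T :=
  closed_ideal_generated
    [set t | exists x y : E, vdisjoint x y /\ t = tens x y].

(* Signed power: t^p = |t|^p sign t. *)
Definition spow (t p : R) : R := Num.sg t * `|t| `^ p.

Definition oplus (E : banachLatticeType R) (e : nat -> E) (x y : E) : E :=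
  limn (series (fun i =>
    spow (spow (coord e x i) 2 + spow (coord e y i) 2) 2^-1 *: e i)).

Definition odot (E : banachLatticeType R) (a : R) (x : E) : E :=
  spow a 2^-1 *: x.

Definition conc_norm (E : banachLatticeType R) (e : nat -> E) (x : E) : R :=
  inf [set \sum_(v <- s) `|v| ^+ 2 | s in
    [set s : seq E | (forall v, v \in s -> vle 0 v) /\
                     vle (vabs x) (\big[oplus e/0]_(v <- s) v)]].

(* iota : E -> C exhibits C as the completion of the 2-concavification of E,
   i.e. of the set E with the operations oplus e and odot, the order of E and
   the norm conc_norm e. *)
Definition is_conc_completion (E C : banachLatticeType R) (e : nat -> E)
    (iota : E -> C) : Prop :=
  [/\ {morph iota : x y / oplus e x y >-> x + y},
      forall (a : R) (x : E), iota (odot a x) = a *: iota x,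
      lattice_morphism iota, forall x, `|iota x| = conc_norm e x
    & dense (range iota)].

End BanachLatticeNotions.

(* Main.v *)
(* Write x_i for the coordinates of x and g_i = e_i (x) e_i.  The map
   (x, y) |-> x^(1/2) y^(1/2), taken coordinatewise with signed powers, is a
   positive bilinear contraction of E x E into the completed concavification,
   so it induces a positive contraction Phi of the tensor product.

   Truncating to the diagonal, t |-> sum_(i < N) t_ii g_i, lies between 0 and
   the identity on the positive cone.  On diagonal sums Phi is isometric: if
   |x| <= v_1 (+) ... (+) v_n with x_i^2 = |u_i|, then the sum of the |u_i| g_i
   is at most the sum of the v_k (x) v_k, whose norm is at most the sum of the
   |v_k|^2.  Since Phi of the N-th truncation of t tends to Phi t, the
   truncations of t converge to some P t, with Phi (P t) = Phi t and
   |P t| <= |Phi t|.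

   Phi is a lattice homomorphism because disjoint positive tensors have
   disjoint diagonals, and its kernel is I_oc because x (x) y - P (x (x) y) is
   a limit of off-diagonal sums.  So Phi factors through an isometry of the
   quotient; it is onto because Phi (x (x) |x|) is the image of x. *)

From Pilot Require Import Defs.
From HB Require Import structures.
From mathcomp Require Import all_boot all_order all_algebra.
From mathcomp Require Import all_classical all_reals all_analysis.
From mathcomp Require Import ring lra.
Set Implicit Arguments.
Unset Strict Implicit.
Unset Printing Implicit Defensive.
Import Order.TTheory GRing.Theory Num.Theory.
Import numFieldNormedType.Exports.
Local Open Scope classical_set_scope.
Local Open Scope ring_scope.
Local Arguments vle_trans {R s} [y x z].
Local Arguments vle_add2r {R s} z [x y].
Local Arguments vle_anti {R s} [x y].
Local Notation coord := Pilot.Defs.coord.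

(** * Order and norm calculus in a Banach lattice *)

Section Riesz.
Variables (R : realType) (E : banachLatticeType R).
Implicit Types x y z d : E.

Lemma vle_sub_ge0 x y : vle 0 (y - x) = vle x y.
Proof.
apply/idP/idP => h.
  by have := vle_add2r x h; rewrite add0r subrK.
by have := vle_add2r (- x) h; rewrite subrr.
Qed.

Lemma vleD x y x' y' : vle x y -> vle x' y' -> vle (x + x') (y + y').
Proof.
move=> h h'; apply: vle_trans (vle_add2r x' h) _.
by rewrite ![y + _]addrC; exact: vle_add2r.
Qed.

Lemma vle0D x y : vle 0 x -> vle 0 y -> vle 0 (x + y).
Proof. by move=> hx hy; rewrite -[0]addr0; exact: vleD. Qed.

Lemma vleN x y : vle (- x) (- y) = vle y x.
Proof. by rewrite -vle_sub_ge0 opprK addrC vle_sub_ge0. Qed.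

Lemma vle_sum (I : Type) (s : seq I) (P : pred I) (f g : I -> E) :
  (forall i, P i -> vle (f i) (g i)) ->
  vle (\sum_(i <- s | P i) f i) (\sum_(i <- s | P i) g i).
Proof.
move=> h; elim/big_rec2: _ => [|i a b Pi ab]; first exact: vle_refl.
by apply: vleD => //; exact: h.
Qed.

Lemma vle0_sum (I : Type) (s : seq I) (P : pred I) (f : I -> E) :
  (forall i, P i -> vle 0 (f i)) -> vle 0 (\sum_(i <- s | P i) f i).
Proof.
move=> h; elim/big_rec: _ => [|i a Pi]; first exact: vle_refl.
by apply: vle0D; exact: h.
Qed.

Lemma vle_scalel (a b : R) x : a <= b -> vle 0 x -> vle (a *: x) (b *: x).
Proof.
move=> ab x0; rewrite -vle_sub_ge0 -scalerBl.
by apply: vle_scale; rewrite // subr_ge0.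
Qed.

Lemma vle_joinl x y : vle x (vjoin x y).
Proof. by have := vle_refl (vjoin x y); rewrite vle_joinP => /andP[]. Qed.

Lemma vle_joinr x y : vle y (vjoin x y).
Proof. by have := vle_refl (vjoin x y); rewrite vle_joinP => /andP[]. Qed.

Lemma vle_meetl x y : vle (vmeet x y) x.
Proof. by have := vle_refl (vmeet x y); rewrite vle_meetP => /andP[]. Qed.

Lemma vle_meetr x y : vle (vmeet x y) y.
Proof. by have := vle_refl (vmeet x y); rewrite vle_meetP => /andP[]. Qed.

Lemma vmeet_eql x y : vle x y -> vmeet x y = x.
Proof.
by move=> h; apply: vle_anti; rewrite vle_meetl vle_meetP vle_refl.
Qed.

Lemma vjoinC x y : vjoin x y = vjoin y x.
Proof.
by apply: vle_anti; rewrite !vle_joinP !vle_joinl !vle_joinr.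
Qed.

Lemma vmeetD2r z x y : vmeet (x + z) (y + z) = vmeet x y + z.
Proof.
have h (a b c : E) : vle (vmeet a b + c) (vmeet (a + c) (b + c)).
  by rewrite vle_meetP !vle_add2r ?vle_meetl ?vle_meetr.
apply: vle_anti; rewrite h andbT.
(* The reverse inequality is [h] for the translated pair, shifted back by [- z]. *)
by have /(vle_add2r z) := h (x + z) (y + z) (- z); rewrite !addrK subrK.
Qed.

Lemma vjoin_oppmeet x y : vjoin x y = - vmeet (- x) (- y).
Proof.
apply: vle_anti; apply/andP; split.
  by rewrite vle_joinP -[X in vle X _]opprK vleN vle_meetl
    -[X in vle X _]opprK vleN vle_meetr.
by rewrite -vleN opprK vle_meetP !vleN vle_joinl vle_joinr.
Qed.

Lemma vabs_lel x : vle x (vabs x). Proof. exact: vle_joinl. Qed.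

Lemma vabs_leN x : vle (- x) (vabs x). Proof. exact: vle_joinr. Qed.

Lemma vabs_le x y : vle (vabs x) y = vle x y && vle (- x) y.
Proof. exact: vle_joinP. Qed.

Lemma vabs_ge0 x : vle 0 (vabs x).
Proof.
(* Adding the two bounds by [vabs x] gives [0] below twice the modulus, which is then halved. *)
have := vleD (vabs_lel x) (vabs_leN x); rewrite subrr -mulr2n -scaler_nat.
move=> /(@vle_scale _ _ 2^-1 _); rewrite scalerA mulVf ?pnatr_eq0// scale1r.
by apply; rewrite invr_ge0.
Qed.

Lemma vabs_pos x : vle 0 x -> vabs x = x.
Proof.
move=> x0; apply: vle_anti; rewrite vabs_lel vabs_le vle_refl/= andbT.
by apply: (vle_trans _ x0); rewrite -vleN opprK oppr0.
Qed.

Lemma vabs_id x : vabs (vabs x) = vabs x.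
Proof. exact/vabs_pos/vabs_ge0. Qed.

Lemma vabsN x : vabs (- x) = vabs x.
Proof. by rewrite /vabs opprK vjoinC. Qed.

Lemma vabsD x y : vle (vabs (x + y)) (vabs x + vabs y).
Proof.
by rewrite vabs_le opprD !vleD// ?vabs_lel ?vabs_leN.
Qed.

Lemma vabsZ_le (a : R) x : vle (vabs (a *: x)) (`|a| *: vabs x).
Proof.
have h (b : R) (z : E) : 0 <= b -> vle (vabs (b *: z)) (b *: vabs z).
  move=> b0; rewrite vabs_le -scalerN -!(vle_sub_ge0 (b *: _)) -!scalerBr.
  by rewrite !vle_scale// vle_sub_ge0 ?vabs_lel ?vabs_leN.
case: (leP 0 a) => a0; first by rewrite ger0_norm// h.
rewrite ltr0_norm// -(vabsN x) -[a]opprK scaleNr -scalerN opprK.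
by rewrite h// oppr_ge0 ltW.
Qed.

Lemma vabs_sum (I : Type) (s : seq I) (P : pred I) (f : I -> E) :
  vle (vabs (\sum_(i <- s | P i) f i)) (\sum_(i <- s | P i) vabs (f i)).
Proof.
elim/big_rec2: _ => [|i a b Pi ab]; first by rewrite vabs_pos vle_refl.
by apply: vle_trans (vabsD _ _) _; apply: vleD (vle_refl _) ab.
Qed.

Lemma vnorm_abs x : `|vabs x| = `|x|.
Proof.
by apply/eqP; rewrite eq_le !vnorm_le// -![vjoin _ (- _)]/(vabs _) vabs_id
  vle_refl.
Qed.

Lemma vnorm_le_abs x y : vle (vabs x) y -> `|x| <= `|y|.
Proof.
move=> h; apply: vnorm_le; rewrite -![vjoin _ (- _)]/(vabs _).
exact: vle_trans h (vabs_lel _).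
Qed.

Lemma vnorm_le_pos x y : vle 0 x -> vle x y -> `|x| <= `|y|.
Proof. by move=> x0 xy; apply: vnorm_le_abs; rewrite vabs_pos. Qed.

Lemma vmeet_le_add x y x' y' :
  vle (vmeet x y) (vmeet x' y' + (vabs (x - x') + vabs (y - y'))).
Proof.
rewrite -vmeetD2r vle_meetP; apply/andP; split.
  apply: vle_trans (vle_meetl x y) _; rewrite -{1}(subrKC x' x).
  apply: vleD (vle_refl _) _; rewrite -[x - x']addr0.
  by apply: vleD; rewrite ?vabs_ge0 ?vabs_lel ?addr0 ?vabs_lel.
apply: vle_trans (vle_meetr x y) _; rewrite -{1}(subrKC y' y).
apply: vleD (vle_refl _) _; rewrite -[y - y']add0r.
by apply: vleD; rewrite ?vabs_ge0 ?add0r ?vabs_lel.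
Qed.

(** The one-sided estimate [vmeet_le_add], used in both directions, bounds the modulus of the
    difference. This makes the lattice operations continuous and the positive cone closed. *)
Lemma vmeet_dist x y x' y' :
  `|vmeet x y - vmeet x' y'| <= `|x - x'| + `|y - y'|.
Proof.
rewrite -[`|x - _|]vnorm_abs -[`|y - _|]vnorm_abs.
apply: le_trans (ler_normD _ _); apply: vnorm_le_abs.
have h (a b a' b' : E) :
    vle (vmeet a b - vmeet a' b') (vabs (a - a') + vabs (b - b')).
  have := vle_add2r (- vmeet a' b') (vmeet_le_add a b a' b').
  by rewrite (addrC (vmeet a' b')) addrK.
by rewrite vabs_le h opprB -(vabsN (x - x')) -(vabsN (y - y')) !opprB h.
Qed.

End Riesz.

Lemma lattice_morphism_monotone (R : realType) (E F : banachLatticeType R)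
    (f : E -> F) (x y : E) :
  lattice_morphism f -> vle x y -> vle (f x) (f y).
Proof. by move=> [_ fm] xy; rewrite -(vmeet_eql xy) fm vle_meetr. Qed.

(** Subtracting [vmeet x y] from [x] and [y] leaves elements with meet 0, so preserving such pairs
    is enough for meets. Joins follow by negation. *)
Lemma linear_lattice_morphism (R : realType) (E F : banachLatticeType R)
    (f : {linear E -> F}) :
  (forall x y, vmeet x y = 0 -> vmeet (f x) (f y) = 0) -> lattice_morphism f.
Proof.
move=> f0.
have fm : {morph f : x y / vmeet x y}.
  move=> x y; have := f0 (x - vmeet x y) (y - vmeet x y).
  rewrite !linearB !vmeetD2r !subrr => /(_ erefl)/eqP.
  by rewrite subr_eq0 => /eqP.
by split=> // x y; rewrite !vjoin_oppmeet linearN fm !linearN.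
Qed.


(** * Limits, density and extension of contractions in normed spaces *)

Section NormedModules.
Variables (R : realType).

Lemma cvgn_distP (V : normedModType R) (u : nat -> V) (x : V) :
  u @ \oo --> x <->
  forall eps : R, 0 < eps ->
    exists N, forall n, (N <= n)%N -> `|x - u n| < eps.
Proof.
split=> [/cvgrPdist_lt h eps /h [N _ hN]|h].
  by exists N => n Nn; exact: hN.
by apply/cvgrPdist_lt => eps /h [N hN]; exists N.
Qed.

Lemma cauchy_seq_cvgn (V : completeNormedModType R) (u : nat -> V) :
  (forall eps : R, 0 < eps ->
    exists N, forall m n, (N <= m)%N -> (N <= n)%N -> `|u m - u n| < eps) ->
  exists x : V, u @ \oo --> x.
Proof.
move=> h; suff : cvgn u by exists (limn u).
apply: (@cauchy_cvg V (u @ \oo)).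
apply: cauchy_exP => eps /h [N hN].
exists (u N), N => // n /= Nn.
by rewrite -ball_normE /=; exact: hN.
Qed.

Lemma closure_normP (V : normedModType R) (A : set V) (x : V) :
  closure A x <-> forall eps : R, 0 < eps -> exists2 a, A a & `|x - a| < eps.
Proof.
split=> [h eps e0|h B /nbhs_ballP [eps /= e0 hB]].
  have [a [Aa]] := h _ (nbhsx_ballx x eps e0).
  by rewrite -ball_normE; exists a.
by have [a Aa xa] := h _ e0; exists a; split=> //; apply: hB; rewrite -ball_normE.
Qed.

Lemma dense_normP (V : normedModType R) (A : set V) :
  dense A -> forall (x : V) (eps : R), 0 < eps ->
    exists2 a, A a & `|x - a| < eps.
Proof.
move=> dA x eps e0.
have [||a [xa Aa]] := dA (ball x eps).
- by exists x; exact: ballxx.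
- exact: ball_open.
by exists a => //; move: xa; rewrite -ball_normE.
Qed.

Lemma contraction_cvgn (V W : normedModType R) (f : {linear V -> W})
    (u : nat -> V) (x : V) :
  (forall v, `|f v| <= `|v|) -> u @ \oo --> x -> (f \o u) @ \oo --> f x.
Proof.
move=> fle /cvgn_distP ux; apply/cvgn_distP => eps /ux [N hN].
by exists N => n /hN; apply: le_lt_trans; rewrite /= -linearB fle.
Qed.

(* The extension is read off the closure of the graph {(a i, b i)}. *)
Lemma dense_contraction_extension (V : normedModType R)
    (W : completeNormedModType R) (I : Type) (a : I -> V) (b : I -> W) :
  dense (range a) ->
  (forall i j, exists2 k, a k = a i + a j & b k = b i + b j) ->
  (forall (c : R) i, exists2 k, a k = c *: a i & b k = c *: b i) ->
  (forall i, `|b i| <= `|a i|) ->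
  exists2 f : {linear V -> W},
    forall i, f (a i) = b i & forall v, `|f v| <= `|v|.
Proof.
move=> da addI scI ble.
pose G v w := forall eps : R, 0 < eps ->
  exists2 i, `|v - a i| < eps & `|w - b i| < eps.
have Gle v w : G v w -> `|w| <= `|v|.
  move=> Gvw; apply/ler_addgt0Pr => eps e0.
  have [i va wb] := Gvw (eps / 2) ltac:(lra).
  have := ler_normD (w - b i) (b i); rewrite subrK => h1.
  have := ler_normD (a i - v) v; rewrite subrK distrC => h2.
  have := ble i; lra.
have GD v w v' w' : G v w -> G v' w' -> G (v + v') (w + w').
  move=> h h' eps e0.
  have [i va wb] := h (eps / 2) ltac:(lra).
  have [j va' wb'] := h' (eps / 2) ltac:(lra).
  have [k ak bk] := addI i j; exists k; rewrite (ak, bk) opprD addrACA.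
    by apply: (le_lt_trans (ler_normD _ _)); lra.
  by apply: (le_lt_trans (ler_normD _ _)); lra.
have GZ c v w : G v w -> G (c *: v) (c *: w).
  move=> h eps e0.
  have c0 : 0 < `|c| + 1 by rewrite ltr_wpDl.
  have [i va wb] := h (eps / (`|c| + 1)) ltac:(by rewrite divr_gt0).
  have [k ak bk] := scI c i.
  by exists k; rewrite (ak, bk) -scalerBr normrZ;
    apply: (@le_lt_trans _ _ ((`|c| + 1) * _)) (ler_wpM2r _ _) _;
    rewrite ?lerDl// mulrC -ltr_pdivlMr.
(* Approximate [v] by points [a (s n)] at distance below [1/(n+1)]. The points [b (s n)] are then
   Cauchy, and completeness of [W] supplies [w]. *)
have GE v : exists w, G v w.
  have pick (n : nat) : exists i, `|v - a i| < n.+1%:R^-1.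
    have [_ [i _ <-] hi] := dense_normP da v (eps := n.+1%:R^-1) ltac:(by []).
    by exists i.
  have [s hs] := choice pick.
  have small (eps : R) : 0 < eps -> exists N, forall n, (N <= n)%N ->
      n.+1%:R^-1 < eps.
    move=> e0; have [N _ hN] := near_infty_natSinv_lt (PosNum e0).
    by exists N => n /hN.
  have bdist i j : `|b i - b j| <= `|a i - a j|.
    have [k ak bk] := scI (-1) j; have [l al bl] := addI i k.
    by move: (ble l); rewrite al bl ak bk !scaleN1r.
  have [eps e0|w /cvgn_distP hw] := @cauchy_seq_cvgn W (b \o s).
    have [N hN] := small (eps / 2) ltac:(lra).
    exists N => m n /hN hm /hN hn /=; apply: le_lt_trans (bdist _ _) _.
    rewrite -[X in X - _](subrK v) -addrA.
    apply: le_lt_trans (ler_normD _ _) _; rewrite distrC.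
    rewrite [ltRHS]splitr.
    by apply: ltrD; [exact: lt_trans (hs m) hm|exact: lt_trans (hs n) hn].
  exists w => eps e0; have [N hN] := small eps e0; have [M hM] := hw eps e0.
  exists (s (maxn M N)); last by apply: hM; rewrite leq_maxl.
  by apply: lt_trans (hs _) _; apply: hN; rewrite leq_maxr.
have [f fG] := choice GE.
(* The closed graph is single-valued: the difference of two values over [v] lies over 0, and [Gle]
   bounds its norm by 0. Linearity of [f] follows from this. *)
have Gf v w : G v w -> f v = w.
  move=> h; apply/eqP; rewrite -subr_eq0 -normr_le0.
  have := GD _ _ _ _ (fG v) (GZ (-1) _ _ h).
  by rewrite !scaleN1r subrr => /Gle; rewrite normr0.
have flin : linear f by move=> c x y; apply: Gf; apply: GD => //; exact: GZ.
pose fL := GRing.isLinear.Build R V W _ f flin.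
pose F : {linear V -> W} := HB.pack f fL.
exists F => [i|v]; last exact: Gle (fG v).
by apply: Gf => eps e0; exists i; rewrite subrr normr0.
Qed.

Lemma cvgn_unique (V : normedModType R) (u : nat -> V) (x y : V) :
  u @ \oo --> x -> u @ \oo --> y -> x = y.
Proof. exact: (@cvg_unique V). Qed.

(** Supplies the closedness premise when an inclusion is proved by density in the tensor product. *)
Lemma lipschitz_closed_preimage (V W : normedModType R)
    (f : V -> W) (K : R) (A : set W) :
  0 < K -> (forall s t, `|f s - f t| <= K * `|s - t|) -> closed A ->
  closed [set t | A (f t)].
Proof.
move=> K0 fK Acl t clt; apply/Acl/closure_normP => eps e0.
have [s As ts] := (closure_normP _ _).1 clt _ (divr_gt0 e0 K0).
exists (f s) => //; apply: le_lt_trans (fK _ _) _.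
by rewrite mulrC -ltr_pdivlMr.
Qed.

End NormedModules.

(** * Continuity of meets and closedness of the positive cone *)

Section LatticeLimits.
Variables (R : realType) (E : banachLatticeType R).

Lemma vmeet_cvgn (u v : nat -> E) (x y : E) :
  u @ \oo --> x -> v @ \oo --> y -> (fun n => vmeet (u n) (v n)) @ \oo --> vmeet x y.
Proof.
move=> /cvgn_distP ux /cvgn_distP vy; apply/cvgn_distP => eps e0.
have [N hN] := ux (eps / 2) ltac:(lra).
have [M hM] := vy (eps / 2) ltac:(lra).
exists (maxn N M) => n; rewrite geq_max => /andP[/hN h1 /hM h2].
by apply: le_lt_trans (vmeet_dist _ _ _ _) _; lra.
Qed.

Lemma closure_vle0 (A : set E) (x : E) :
  (forall a, A a -> vle 0 a) -> closure A x -> vle 0 x.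
Proof.
move=> A0 /closure_normP clA.
(* Nonnegativity of [x] is the equation [vmeet 0 x = 0]. It holds at nearby points of [A], and
   [vmeet_dist] carries it to [x]. *)
suff /eqP : vmeet 0 x - 0 = 0 by rewrite subr_eq0 => /eqP <-; exact: vle_meetr.
apply/eqP; rewrite -normr_le0; apply/ler_addgt0Pr => eps /clA [a /A0 a0 xa].
rewrite -[X in _ - X](vmeet_eql a0) add0r; apply: le_trans (vmeet_dist _ _ _ _) _.
by rewrite subrr normr0 add0r ltW.
Qed.

Lemma closed_vle0 : closed [set x : E | vle 0 x].
Proof. by move=> x; apply: closure_vle0. Qed.

End LatticeLimits.

(** * Signed squares and square roots of real numbers *)

Section SignedPowers.
Variable R : realType.
Implicit Types t a b c p : R.

Lemma spow0 p : spow 0 p = 0 :> R.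
Proof. by rewrite /spow sgr0 mul0r. Qed.

Lemma spow1 p : spow 1 p = 1 :> R.
Proof. by rewrite /spow sgr1 normr1 powR1 mul1r. Qed.

Lemma spowM a b p : spow (a * b) p = spow a p * spow b p.
Proof. by rewrite /spow sgrM normrM powRM// mulrACA. Qed.

Lemma spow_ge0 t p : 0 <= t -> 0 <= spow t p.
Proof. by move=> t0; rewrite mulr_ge0 ?powR_ge0 ?sgr_ge0. Qed.

Lemma spow2E t : spow t 2 = t * `|t|.
Proof. by rewrite /spow powR_mulrn// expr2 mulrA -numEsg. Qed.

Lemma spow2_pos t : 0 <= t -> spow t 2 = t ^+ 2.
Proof. by move=> t0; rewrite spow2E ger0_norm. Qed.

Lemma spowK t p : p != 0 -> spow (spow t p) p^-1 = t.
Proof.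
move=> p0; have [->|t0] := eqVneq t 0; first by rewrite !spow0.
rewrite /spow sgrM sgr_id [X in _ * X * _]gtr0_sg ?powR_gt0 ?normr_gt0//.
rewrite mulr1 normrM.
rewrite normr_sg t0 mul1r ger0_norm ?powR_ge0// -powRrM mulfV// powRr1//.
by rewrite -numEsg.
Qed.

Lemma spow_sqrtK t : spow (spow t 2^-1) 2 = t.
Proof. by rewrite -[X in spow _ X]invrK spowK// invr_eq0 pnatr_eq0. Qed.

Lemma spow_sqrK t : spow (spow t 2) 2^-1 = t.
Proof. by rewrite spowK// pnatr_eq0. Qed.

Lemma spow_sqrt_le t c : 0 <= c -> `|t| <= c ^+ 2 -> `|spow t 2^-1| <= c.
Proof.
move=> c0 tc; rewrite -(ler_pXn2r (n := 2))// ?nnegrE//.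
apply: le_trans tc; have := spow2E (spow t 2^-1); rewrite spow_sqrtK.
by move=> /(congr1 Num.norm) ->; rewrite [leRHS]normrM normr_id expr2.
Qed.

End SignedPowers.

(** * Coordinates with respect to the basis, and the concavification norm *)

Section Basis.
Variables (R : realType) (E : banachLatticeType R) (e : nat -> E).
Hypothesis e_basis : lattice_basis e.
Implicit Types (x y z : E) (a b : nat -> R).

Definition psum a N : E := \sum_(i < N) a i *: e i.

Lemma series_psum a : series (fun i => a i *: e i) = psum a.
Proof. by apply/funext => N; rewrite /series /= big_mkord. Qed.

Lemma coordP x : psum (coord e x) @ \oo --> x.
Proof.
rewrite -series_psum; have [a [ha _]] := e_basis.1 x.
by rewrite /coord; case: xgetP => [b _ //|/(_ a)].
Qed.

Local Arguments coordP : clear implicits.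

Lemma coord_eq x a : psum a @ \oo --> x -> coord e x = a.
Proof.
move=> ha; have [b [_ hb]] := e_basis.1 x.
have := coordP x; rewrite -series_psum => /hb <-.
by move: ha; rewrite -series_psum => /hb.
Qed.

Lemma coord_linear (c : R) x y i :
  coord e (c *: x + y) i = c * coord e x i + coord e y i.
Proof.
suff -> : coord e (c *: x + y) = fun i => c * coord e x i + coord e y i by [].
apply: coord_eq.
have -> : psum (fun i => c * coord e x i + coord e y i) =
    (fun N => c *: psum (coord e x) N + psum (coord e y) N).
  apply/funext => N; rewrite /psum scaler_sumr -big_split; apply: eq_bigr => j _.
  by rewrite scalerDl scalerA.
apply: (@cvgD _ E); last exact: coordP.
by apply: (@cvgZr _ E); exact: coordP.
Qed.

Lemma coord0 i : coord e 0 i = 0.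
Proof. by have := coord_linear (-1) 0 0 i; rewrite scaler0 addr0; lra. Qed.

Lemma coordZ (c : R) x i : coord e (c *: x) i = c * coord e x i.
Proof. by rewrite -[c *: x]addr0 coord_linear coord0 addr0. Qed.

Lemma coordD x y i : coord e (x + y) i = coord e x i + coord e y i.
Proof. by rewrite -[x]scale1r coord_linear mul1r scale1r. Qed.

Lemma coordN x i : coord e (- x) i = - coord e x i.
Proof. by rewrite -scaleN1r coordZ mulN1r. Qed.

Lemma coordB x y i : coord e (x - y) i = coord e x i - coord e y i.
Proof. by rewrite coordD coordN. Qed.

Lemma coord_inj x y : (forall i, coord e x i = coord e y i) -> x = y.
Proof.
move=> /funext xy; apply: cvgn_unique (coordP x) _; rewrite xy.
exact: coordP.
Qed.

Lemma coord_psum a N i : coord e (psum a N) i = if (i < N)%N then a i else 0.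
Proof.
suff -> : coord e (psum a N) = fun i => if (i < N)%N then a i else 0 by [].
apply: coord_eq; apply/cvgn_distP => eps e0; exists N => n Nn.
suff -> : psum (fun i => if (i < N)%N then a i else 0) n = psum a N.
  by rewrite subrr normr0.
rewrite /psum (big_ord_widen n (fun i => a i *: e i))// [RHS]big_mkcond.
by apply: eq_bigr => j _; case: ifP; rewrite ?scale0r.
Qed.

Lemma coord_basis i j : coord e (e i) j = (i == j)%:R.
Proof.
have -> : e i = psum (fun j => (i == j)%:R) i.+1.
  rewrite /psum big_ord_recr/= eqxx scale1r big1 ?add0r// => k _.
  by rewrite gtn_eqF ?scale0r.
rewrite coord_psum; have [->|] := eqVneq i j; first by rewrite ltnSn.
by case: ifP.
Qed.

Lemma vle_coord x y : vle x y <-> forall i, coord e x i <= coord e y i.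
Proof.
rewrite -vle_sub_ge0.
have := e_basis.2 (coord e (y - x)) (y - x); rewrite series_psum.
move=> /(_ (coordP _)) ->.
by split=> h i; have := h i; rewrite coordB subr_ge0.
Qed.

Lemma vle0_coord x : vle 0 x <-> forall i, 0 <= coord e x i.
Proof. by rewrite vle_coord; split=> h i; have := h i; rewrite coord0. Qed.

Lemma basis_ge0 i : vle 0 (e i).
Proof. by apply/vle0_coord => j; rewrite coord_basis. Qed.

(* Lowering the i-th coordinate of the join to the maximum keeps an upper
   bound. *)
Lemma coord_join x y i :
  coord e (vjoin x y) i = Num.max (coord e x i) (coord e y i).
Proof.
set m := Num.max _ _; set z := vjoin x y.
have /vle_coord hx : vle x z := vle_joinl x y.
have /vle_coord hy : vle y z := vle_joinr x y.
apply/eqP; rewrite eq_le ge_max hx hy !andbT.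
suff /vle_coord/(_ i) : vle z (z - (coord e z i - m) *: e i).
  by rewrite coordB coordZ coord_basis eqxx mulr1; lra.
rewrite vle_joinP; apply/andP; split; apply/vle_coord => j;
  rewrite coordB coordZ coord_basis; have [<-|_] := eqVneq i j;
  rewrite ?mulr1 ?mulr0 ?subr0 ?hx ?hy// subKr /m le_max lexx ?orbT//.
Qed.

Lemma coord_abs x i : coord e (vabs x) i = `|coord e x i|.
Proof. by rewrite coord_join coordN maxrN. Qed.

Lemma coord_meet x y i :
  coord e (vmeet x y) i = Num.min (coord e x i) (coord e y i).
Proof.
have := vjoin_oppmeet (- x) (- y); rewrite !opprK => /(congr1 -%R).
by rewrite opprK => <-; rewrite coordN coord_join !coordN oppr_max !opprK.
Qed.

Lemma norm_coord_le x y :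
  (forall i, `|coord e x i| <= `|coord e y i|) -> `|x| <= `|y|.
Proof. by move=> h; apply/vnorm_le/vle_coord => i; rewrite !coord_abs. Qed.

Lemma norm_basis_gt0 i : 0 < `|e i|.
Proof.
rewrite normr_gt0; apply/eqP => /(congr1 (fun x => coord e x i)).
by rewrite coord_basis eqxx coord0; apply/eqP/oner_neq0.
Qed.

Lemma coord_norm_le x i : `|coord e x i| * `|e i| <= `|x|.
Proof.
rewrite -normrZ; apply: norm_coord_le => j; rewrite coordZ coord_basis.
by have [<-|_] := eqVneq i j; rewrite ?mulr1 ?mulr0 ?normr0.
Qed.

Lemma psum_tail_cvg0 x (eps : R) : 0 < eps ->
  exists N, forall n, (N <= n)%N -> `|x - psum (coord e x) n| < eps.
Proof. by have /cvgn_distP := coordP x; apply. Qed.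

(** [limn] has a default value on divergent series, so [vec a] is meaningful only once convergence
    is known, as in [coord_vec]. By this form [oplus] is an instance of [vec]. *)
Definition vec a : E := limn (series (fun i => a i *: e i)).

(** Domination gives convergence: each block of the series of [a] past [N] is coordinatewise below
    the tail of [x], whose norm tends to 0. *)
Lemma coord_vec a x : (forall i, `|a i| <= coord e x i) -> coord e (vec a) = a.
Proof.
move=> ax; apply: coord_eq; rewrite /vec series_psum.
suff [y hy] : exists y : E, psum a @ \oo --> y.
  by have /cvg_lim -> := hy.
apply: cauchy_seq_cvgn => eps e0.
have [N hN] := psum_tail_cvg0 x (eps := eps / 2) ltac:(lra).
have tail n : (N <= n)%N -> `|psum a n - psum a N| < eps / 2.
  move=> Nn; apply: le_lt_trans (hN N (leqnn N)); apply: norm_coord_le => i.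
  rewrite !coordB !coord_psum; case: (ltnP i N) => iN.
    by rewrite (leq_trans iN Nn) !subrr.
  rewrite !subr0; case: ifP => _; last by rewrite normr0.
  by rewrite [leRHS]ger0_norm// (le_trans _ (ax i)).
exists N => m n Nm Nn; rewrite -(subrK (psum a N) (psum a m)) -addrA.
apply: le_lt_trans (ler_normD _ _) _; rewrite [X in _ + X]distrC.
by have := tail m Nm; have := tail n Nn; lra.
Qed.

Lemma coord_oplus x y i :
  coord e (oplus e x y) i =
  spow (spow (coord e x i) 2 + spow (coord e y i) 2) 2^-1.
Proof.
(* The dominating vector works because [a^2 + b^2 <= (a + b)^2] for nonnegative [a] and [b]. *)
rewrite -[oplus e x y]/(vec _) (coord_vec (x := vabs x + vabs y))// => j.
rewrite coordD !coord_abs; apply: spow_sqrt_le; first by rewrite addr_ge0.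
rewrite !spow2E; apply: le_trans (ler_normD _ _) _; rewrite !normrM !normr_id.
set a := `|coord e x j|; set b := `|coord e y j|.
have : 0 <= a * b by rewrite mulr_ge0 ?normr_ge0.
by rewrite sqrrD !expr2 => ?; lra.
Qed.

Lemma oplus0 x : oplus e x 0 = x.
Proof.
by apply: coord_inj => i; rewrite coord_oplus coord0 spow0 addr0 spow_sqrK.
Qed.

Lemma coord_big_oplus (s : seq E) i :
  spow (coord e (\big[oplus e/0]_(v <- s) v) i) 2 =
  \sum_(v <- s) spow (coord e v i) 2.
Proof.
elim: s => [|v s IH]; first by rewrite !big_nil coord0 spow0.
by rewrite !big_cons coord_oplus spow_sqrtK IH.
Qed.

Definition conc_sums x : set R :=
  [set \sum_(v <- s) `|v| ^+ 2 | s in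
    [set s : seq E | (forall v, v \in s -> vle 0 v) /\
                     vle (vabs x) (\big[oplus e/0]_(v <- s) v)]].

Lemma conc_sums_norm x : conc_sums x (`|x| ^+ 2).
Proof.
exists [:: vabs x]; last by rewrite big_seq1 vnorm_abs.
split=> [v|]; first by rewrite inE => /eqP ->; exact: vabs_ge0.
by rewrite big_cons big_nil oplus0 vle_refl.
Qed.

Lemma conc_norm_le x : conc_norm e x <= `|x| ^+ 2.
Proof.
apply: ge_inf; last exact: conc_sums_norm.
by exists 0 => _ [s _ <-]; apply: sumr_ge0 => v _; exact: exprn_ge0.
Qed.

(** Squaring coordinates turns [oplus] into ordinary addition, so the admissible decompositions are
    read off real inequalities between sums of squares. *)
Lemma conc_norm_ge x (c : R) :
  (forall s : seq E, (forall v, v \in s -> vle 0 v) ->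
     (forall i, `|spow (coord e x i) 2| <= \sum_(v <- s) coord e v i ^+ 2) ->
     c <= \sum_(v <- s) `|v| ^+ 2) ->
  c <= conc_norm e x.
Proof.
move=> h; apply: lb_le_inf; first by exists (`|x| ^+ 2); exact: conc_sums_norm.
move=> _ [s [s0 /vle_coord xs] <-]; apply: h => // i.
have -> : \sum_(v <- s) coord e v i ^+ 2 =
    spow (coord e (\big[oplus e/0]_(v <- s) v) i) 2.
  rewrite coord_big_oplus !big_seq; apply: eq_bigr => v /s0/vle0_coord/(_ i).
  by move=> /spow2_pos.
have := xs i; rewrite coord_abs => xi.
rewrite spow2E normrM normr_id -expr2 spow2_pos ?(le_trans _ xi)//.
by rewrite ler_pXn2r ?nnegrE// (le_trans _ xi).
Qed.

End Basis.

(** * The Fremlin tensor product: norm, induction principles, universal property *)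

Section Tensor.
Variables (R : realType) (E F T : banachLatticeType R).
Variable tens : {bilinear E -> F -> T}.
Hypothesis T_tensor : is_fremlin_tensor tens.

Lemma tsum_cat (G : banachLatticeType R) (phi : {bilinear E -> F -> G})
    (s s' : seq (E * F)) : tsum phi (s ++ s') = tsum phi s + tsum phi s'.
Proof. by rewrite /tsum big_cat. Qed.

Lemma tsum_scale (G : banachLatticeType R) (phi : {bilinear E -> F -> G})
    (c : R) (s : seq (E * F)) :
  tsum phi [seq (c *: p.1, p.2) | p <- s] = c *: tsum phi s.
Proof.
by rewrite /tsum big_map scaler_sumr; apply: eq_bigr => p _; rewrite linearZl_LR.
Qed.

Lemma bilinear_contraction_le (G : banachLatticeType R)
    (phi : {bilinear E -> F -> G}) x y :
  bilinear_contraction phi -> `|phi x y| <= `|x| * `|y|.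
Proof.
move=> phi1.
have [->|x0] := eqVneq x 0; first by rewrite linear0l !normr0 mul0r.
have [->|y0] := eqVneq y 0; first by rewrite linear0r !normr0 mulr0.
have unit (V : normedModType R) (v : V) : v != 0 -> `| `|v|^-1 *: v| <= 1.
  by move=> v0; rewrite normrZ normfV normr_id mulVf// normr_eq0.
have := phi1 _ _ (unit _ _ x0) (unit _ _ y0).
rewrite linearZl_LR linearZr_LR /= !normrZ !normfV !normr_id.
rewrite mulrCA -ler_pdivlMl ?invr_gt0 ?normr_gt0// invrK mulr1.
by rewrite -ler_pdivlMl ?invr_gt0 ?normr_gt0// invrK.
Qed.

Lemma fremlin_norm_ge (G : banachLatticeType R) (phi : {bilinear E -> F -> G})
    (s : seq (E * F)) :
  positive_bilinear phi -> bilinear_contraction phi ->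
  `|tsum phi s| <= `|tsum tens s|.
Proof.
move=> phi0 phi1; have [-> _ _] := T_tensor.
apply: ub_le_sup; last by exists G, phi.
(* The projective estimate bounds the set from above, so that its [sup] is a genuine least upper
   bound. *)
exists (\sum_(p <- s) `|p.1| * `|p.2|) => _ [H [psi [_ psi1 ->]]].
apply: le_trans (ler_norm_sum _ _ _) _; apply: ler_sum => p _.
exact: bilinear_contraction_le.
Qed.

Lemma tens_norm x y : `|tens x y| <= `|x| * `|y|.
Proof.
have [/(_ [:: (x, y)])] := T_tensor; rewrite /tsum big_seq1/= => -> _ _.
rewrite /fremlin_norm; set A := (X in sup X); have [A0|A0] := pselect (A !=set0).
  apply: ge_sup => // _ [H [psi [_ psi1 ->]]].
  by rewrite /tsum big_seq1/=; exact: bilinear_contraction_le.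
(* For an empty set [sup] takes the default value 0, below the nonnegative right-hand side. *)
by rewrite sup_out ?mulr_ge0// => -[].
Qed.

Lemma tens_ge0 x y : vle 0 x -> vle 0 y -> vle 0 (tens x y).
Proof.
move=> x0 y0; have [_ _ Tpos] := T_tensor.
suff : [set t : T | vle 0 t] (tens x y) by [].
rewrite Tpos; apply: subset_closure; exists [:: (x, y)].
  by move=> p; rewrite inE => /eqP ->.
by rewrite /tsum big_seq1.
Qed.

Lemma tensor_ind (A : set T) :
  A 0 -> (forall s t, A s -> A t -> A (s + t)) ->
  (forall x y, A (tens x y)) -> closed A -> forall t, A t.
Proof.
move=> A0 AD Atens Acl t; apply/Acl/closure_normP => eps e0.
have [_ Tdense _] := T_tensor.
have [_ [s _ <-] ts] := dense_normP Tdense t e0.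
by exists (tsum tens s) => //; apply: big_ind => // p _; exact: Atens.
Qed.

(** The positive cone is the closure of the finite sums of tensors of positive vectors; [A] contains
    these sums and is closed. *)
Lemma tensor_pos_ind (A : set T) :
  A 0 -> (forall s t, A s -> A t -> A (s + t)) ->
  (forall x y, vle 0 x -> vle 0 y -> A (tens x y)) -> closed A ->
  forall t, vle 0 t -> A t.
Proof.
move=> A0 AD Atens Acl t t0; apply: Acl.
have [_ _ Tpos] := T_tensor.
have : [set t : T | vle 0 t] t by [].
rewrite Tpos; apply: closureS => _ [s s0 <-].
rewrite /tsum big_seq; apply: big_ind => // p /s0[p1 p2]; exact: Atens.
Qed.

(** The existence half of the universal property. By [fremlin_norm_ge] the map induced by [phi] is a
    contraction on the dense algebraic tensors, hence extends; its positivity is checked on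
    generators of the cone. *)
Lemma tensor_extension (G : banachLatticeType R)
    (phi : {bilinear E -> F -> G}) :
  positive_bilinear phi -> bilinear_contraction phi ->
  exists f : {linear T -> G},
    [/\ forall x y, f (tens x y) = phi x y, forall t, `|f t| <= `|t|
      & forall t, vle 0 t -> vle 0 (f t)].
Proof.
move=> phi0 phi1; have [_ Tdense _] := T_tensor.
have [i j|c i|i|f fE fle] :=
  @dense_contraction_extension R T G _ (tsum tens) (tsum phi) Tdense.
- by exists (i ++ j); rewrite tsum_cat.
- by exists [seq (c *: p.1, p.2) | p <- i]; rewrite tsum_scale.
- exact: fremlin_norm_ge.
have ftens x y : f (tens x y) = phi x y.
  by have := fE [:: (x, y)]; rewrite /tsum !big_seq1.
exists f; split=> //; apply: tensor_pos_ind.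
- by rewrite linear0 vle_refl.
- by move=> s t s0 t0; rewrite linearD; exact: vle0D.
- by move=> x y x0 y0; rewrite ftens; exact: phi0.
- move=> t /closure_normP clt; apply: closure_vle0 (fun _ => id) _.
  apply/closure_normP => eps /clt[s s0 ts]; exists (f s) => //.
  by rewrite -linearB; exact: le_lt_trans (fle _) ts.
Qed.

End Tensor.

(** * Diagonal sums and coefficient functionals on the tensor product *)

Section TensorBasis.
Variables (R : realType) (E : banachLatticeType R) (e : nat -> E).
Hypothesis e_basis : lattice_basis e.
Variables (T : banachLatticeType R) (tens : {bilinear E -> E -> T}).
Hypothesis T_tensor : is_fremlin_tensor tens.

Definition diag_sum (u : nat -> R) (N : nat) : T :=
  \sum_(i < N) u i *: tens (e i) (e i).

Lemma tens_psum (a b : nat -> R) N :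
  tens (psum e a N) (psum e b N) =
  diag_sum (fun i => a i * b i) N +
  \sum_(i < N) \sum_(j < N | j != i) (a i * b j) *: tens (e i) (e j).
Proof.
rewrite /psum linear_sumlz -big_split; apply: eq_bigr => i _ /=.
rewrite linear_sumr (bigD1 i)//= linearZl_LR linearZr_LR scalerA.
by congr (_ + _); apply: eq_bigr => j _; rewrite linearZl_LR linearZr_LR scalerA.
Qed.

Lemma tens_psum_cvgn x y :
  (fun N => tens (psum e (coord e x) N) (psum e (coord e y) N)) @ \oo
    --> tens x y.
Proof.
apply/cvgn_distP => eps e0.
(* Adding 1 keeps the denominator positive when [x] or [y] is 0. *)
have den (c : R) : 0 <= c -> 0 < eps / 2 / (c + 1).
  by move=> c0; rewrite !divr_gt0// ltr_wpDl.
have [N hN] := psum_tail_cvg0 e_basis x (den `|y| (normr_ge0 _)).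
have [M hM] := psum_tail_cvg0 e_basis y (den `|x| (normr_ge0 _)).
exists (maxn N M) => n; rewrite geq_max => /andP[/hN hx /hM hy].
set xn := psum e _ n; set yn := psum e _ n.
have -> : tens x y - tens xn yn = tens (x - xn) y + tens xn (y - yn).
  by rewrite linearBl linearBr addrA subrK.
apply: le_lt_trans (ler_normD _ _) _.
have xnx : `|xn| <= `|x|.
  apply: (norm_coord_le e_basis) => i; rewrite (coord_psum e_basis).
  by case: ifP => _; rewrite ?normr0.
rewrite [ltRHS]splitr; apply: ltrD.
  apply: le_lt_trans (tens_norm T_tensor _ _) _.
  apply: (@le_lt_trans _ _ (`|x - xn| * (`|y| + 1))).
    by rewrite ler_wpM2l// lerDl.
  by rewrite -ltr_pdivlMr// ltr_wpDl.
apply: le_lt_trans (tens_norm T_tensor _ _) _.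
apply: (@le_lt_trans _ _ ((`|x| + 1) * `|y - yn|)).
  by rewrite ler_wpM2r// (le_trans xnx)// lerDl.
by rewrite mulrC -ltr_pdivlMr// ltr_wpDl.
Qed.

(** Truncating both positive factors decreases the tensor, and by [tens_psum] the truncated tensor
    exceeds its diagonal by off-diagonal terms with nonnegative coefficients. *)
Lemma diag_sum_le_tens x y N : vle 0 x -> vle 0 y ->
  vle (diag_sum (fun i => coord e x i * coord e y i) N) (tens x y).
Proof.
move=> x0 y0; have tens0 := tens_ge0 T_tensor.
have psum0 z : vle 0 z -> vle 0 (psum e (coord e z) N).
  move=> /(vle0_coord e_basis) z0; apply/(vle0_coord e_basis) => i.
  by rewrite (coord_psum e_basis); case: ifP.
have tail0 z : vle 0 z -> vle 0 (z - psum e (coord e z) N).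
  move=> /(vle0_coord e_basis) z0; apply/(vle0_coord e_basis) => i.
  rewrite (coordB e_basis) (coord_psum e_basis).
  by case: ifP; rewrite ?subrr ?subr0.
have le1 : vle (tens (psum e (coord e x) N) (psum e (coord e y) N)) (tens x y).
  rewrite -vle_sub_ge0.
  set xN := psum _ _ _; set yN := psum _ _ _.
  have -> : tens x y - tens xN yN = tens (x - xN) y + tens xN (y - yN).
    by rewrite linearBl linearBr addrA subrK.
  by apply: vle0D; apply: tens0 => //; [exact: tail0|exact: psum0|exact: tail0].
apply: vle_trans le1; rewrite tens_psum -vle_sub_ge0 addrAC subrr add0r.
apply: vle0_sum => i _; apply: vle0_sum => j _; apply: vle_scale.
  by move: x0 y0 => /(vle0_coord e_basis) x0 /(vle0_coord e_basis) y0;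
    exact: mulr_ge0.
by apply: tens0; exact: basis_ge0.
Qed.

Lemma diag_coef_exists i : exists f : {linear T -> R^o},
  [/\ forall x y, f (tens x y) = coord e x i * coord e y i,
      forall t, vle 0 t -> 0 <= f t
    & exists2 K : R, 0 < K & forall t, `|f t| <= K * `|t|].
Proof.
(* The universal property asks for a Banach lattice as target, so the functional takes values on the
   line through [e i]. With the factor [|e i|] the norm of [psi x y] is the product of two numbers
   bounded by [coord_norm_le], which makes [psi] a contraction. *)
pose psi x y : E := (coord e x i * coord e y i * `|e i|) *: e i.
have psiB : bilinear_for *:%R *:%R psi.
  by split=> z c x y; rewrite /psi (coord_linear e_basis) /= scalerA -scalerDl;
    congr (_ *: _); ring.
pose psiH := bilinear_isBilinear.Build R E E E *:%R *:%R psi psiB.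
pose Psi : {bilinear E -> E -> E} := HB.pack psi psiH.
have e0 := norm_basis_gt0 e_basis i.
have [|x y x1 y1|f [fE fle fpos]] := @tensor_extension R E E T tens T_tensor E Psi.
- move=> x y /(vle0_coord e_basis) x0 /(vle0_coord e_basis) y0.
  apply: vle_scale (basis_ge0 e_basis i).
  by rewrite !mulr_ge0.
- rewrite /= /psi normrZ !normrM normr_id -[leLHS]mulrA mulrACA.
  by rewrite mulr_ile1// ?mulr_ge0// (le_trans (coord_norm_le e_basis _ _)).
pose g t : R^o := coord e (f t) i / `|e i|.
have glin : linear g.
  move=> c s t; rewrite /g linearP (coord_linear e_basis) mulrDl -mulrA.
  by [].
pose gL := GRing.isLinear.Build R T R^o _ g glin.
pose G : {linear T -> R^o} := HB.pack g gL.
exists G; split=> [x y|t t0|] /=.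
- rewrite /g fE /= /psi (coordZ e_basis) (coord_basis e_basis) eqxx mulr1.
  by rewrite mulfK ?gt_eqF.
- by rewrite /g divr_ge0//; have /(vle0_coord e_basis) := fpos _ t0; exact.
exists (`|e i|^-1 * `|e i|^-1) => [|t]; first by rewrite mulr_gt0 ?invr_gt0.
rewrite /g normrM normfV normr_id mulrC -mulrA ler_pM2l ?invr_gt0//.
rewrite ler_pdivlMl//.
by rewrite mulrC; apply: le_trans (coord_norm_le e_basis _ _) _.
Qed.

End TensorBasis.

(** * Truncation of a tensor to the diagonal *)

Section DiagonalCoefficients.
Variables (R : realType) (E : banachLatticeType R) (e : nat -> E).
Hypothesis e_basis : lattice_basis e.
Variables (T : banachLatticeType R) (tens : {bilinear E -> E -> T}).
Hypothesis T_tensor : is_fremlin_tensor tens.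

Definition diag_coef i : {linear T -> R^o} :=
  projT1 (cid (diag_coef_exists e_basis T_tensor i)).

Lemma diag_coef_tens i x y :
  diag_coef i (tens x y) = coord e x i * coord e y i.
Proof. by rewrite /diag_coef; case: cid => f []. Qed.

Lemma diag_coef_ge0 i t : vle 0 t -> 0 <= diag_coef i t.
Proof. by rewrite /diag_coef; case: cid => f [] /= _ + _; apply. Qed.

Lemma diag_coef_bound i :
  exists2 K : R, 0 < K & forall t, `|diag_coef i t| <= K * `|t|.
Proof. by rewrite /diag_coef; case: cid => f []. Qed.

Lemma diag_coef_diag_sum i u N :
  diag_coef i (diag_sum e tens u N) = if (i < N)%N then u i else 0.
Proof.
have -> : diag_coef i (diag_sum e tens u N) =
    \sum_(j < N) (if j == i :> nat then u j else 0).
  rewrite /diag_sum linear_sum; apply: eq_bigr => j _.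
  rewrite linearZ diag_coef_tens !(coord_basis e_basis) /=.
  by case: eqP => _; rewrite ?mulr1 ?mulr0 /GRing.scale /= ?mulr1 ?mulr0.
rewrite -big_mkcond; case: ltnP => iN; first by rewrite (big_pred1 (Ordinal iN)).
by rewrite big1// => j /eqP ji; have := ltn_ord j; rewrite ji ltnNge iN.
Qed.

Lemma diag_coef_lim i u t : diag_sum e tens u @ \oo --> t -> diag_coef i t = u i.
Proof.
move=> /cvgn_distP ut; have [K K0 hK] := diag_coef_bound i.
apply/eqP; rewrite -subr_eq0 -normr_le0; apply/ler_addgt0Pr => eps e0.
have [N hN] := ut _ (divr_gt0 e0 K0).
(* The index is at least [i.+1], so that the partial sum already contains the term [i]. *)
have := diag_coef_diag_sum i u (maxn N i.+1).
rewrite leq_max ltnSn orbT => <-; rewrite -linearB add0r.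
apply: le_trans (hK _) _; rewrite mulrC -ler_pdivlMr// ltW// hN//.
by rewrite leq_maxl.
Qed.

Definition diag_part N t : T := diag_sum e tens (diag_coef ^~ t) N.

Lemma diag_part_linear N : linear (diag_part N).
Proof.
move=> c s t; rewrite /diag_part /diag_sum scaler_sumr -big_split.
by apply: eq_bigr => i _; rewrite linearP scalerDl scalerA.
Qed.

Lemma diag_partB N s t : diag_part N (s - t) = diag_part N s - diag_part N t.
Proof.
by have := diag_part_linear N (-1) t s; rewrite !scaleN1r ![- _ + _]addrC.
Qed.

Lemma diag_partD N s t : diag_part N (s + t) = diag_part N s + diag_part N t.
Proof. by have := diag_part_linear N 1 s t; rewrite !scale1r. Qed.

Lemma diag_part0 N : diag_part N 0 = 0.
Proof. by rewrite -[X in diag_part _ X](subrr 0) diag_partB subrr. Qed.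

Lemma diag_part_tens N x y : diag_part N (tens x y) =
  diag_sum e tens (fun i => coord e x i * coord e y i) N.
Proof. by apply: eq_bigr => i _; rewrite diag_coef_tens. Qed.

(** A crude bound that grows with [N]. It gives the continuity needed for [diag_part_le], after
    which [diag_part_norm] improves it to 1. *)
Lemma diag_part_bound N :
  exists2 K : R, 0 < K & forall t, `|diag_part N t| <= K * `|t|.
Proof.
elim: N => [|N [K K0 IH]].
  by exists 1 => // t; rewrite /diag_part /diag_sum big_ord0 normr0 mul1r.
have [L L0 hL] := diag_coef_bound N.
exists (K + L * (`|tens (e N) (e N)| + 1)) => [|t].
  by rewrite ltr_wpDr// mulr_ge0 ?addr_ge0// ltW.
rewrite /diag_part /diag_sum big_ord_recr/=; apply: le_trans (ler_normD _ _) _.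
rewrite mulrDl; apply: lerD; first exact: IH.
by rewrite normrZ mulrAC; apply: ler_pM => //; rewrite lerDl.
Qed.

Lemma diag_part_ge0 N t : vle 0 t -> vle 0 (diag_part N t).
Proof.
move=> t0; apply: vle0_sum => i _; apply: vle_scale; first exact: diag_coef_ge0.
by apply: (tens_ge0 T_tensor); exact: basis_ge0.
Qed.

Lemma diag_part_le N t : vle 0 t -> vle (diag_part N t) t.
Proof.
move=> t0; rewrite -vle_sub_ge0; have [K K0 hK] := diag_part_bound N.
move: t t0; apply: (tensor_pos_ind T_tensor (A := [set t | vle 0 (t - diag_part N t)])).
- by rewrite /= diag_part0 subr0 vle_refl.
- by move=> s s'; rewrite /= diag_partD opprD addrACA; exact: vle0D.
- move=> x y x0 y0; rewrite /= vle_sub_ge0 diag_part_tens.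
  exact: (diag_sum_le_tens e_basis T_tensor).
- apply: (@lipschitz_closed_preimage R T T (fun t => t - diag_part N t) (1 + K)
    [set t | vle 0 t]).
  + by rewrite addr_gt0.
  + move=> s s'; have -> : s - diag_part N s - (s' - diag_part N s') =
        s - s' - diag_part N (s - s').
      by rewrite diag_partB !opprD addrACA.
    by apply: le_trans (ler_normB _ _) _; rewrite mulrDl mul1r lerD2l.
  + exact: closed_vle0.
Qed.

(** Truncation is positive and below the identity on the cone, so the modulus of the truncation of
    [t] is at most the truncation of [vabs t], hence at most [vabs t]. *)
Lemma diag_part_norm N t : `|diag_part N t| <= `|t|.
Proof.
rewrite -(vnorm_abs t); apply: vnorm_le_abs.
apply: vle_trans (diag_part_le N (vabs_ge0 t)).
have h s : vle s (vabs t) -> vle (diag_part N s) (diag_part N (vabs t)).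
  by rewrite -vle_sub_ge0 => /(diag_part_ge0 N); rewrite diag_partB vle_sub_ge0.
rewrite vabs_le h ?vabs_lel//=.
by have := h _ (vabs_leN t); rewrite -[- t]add0r diag_partB diag_part0 !add0r.
Qed.

End DiagonalCoefficients.

(** * Geometric means and the induced map into the completed concavification *)

Section Concavification.
Variables (R : realType) (E : banachLatticeType R) (e : nat -> E).
Hypothesis e_basis : lattice_basis e.
Variables (C : banachLatticeType R) (iota : E -> C).
Hypothesis C_completion : is_conc_completion e iota.

Lemma iota_oplus x y : iota (oplus e x y) = iota x + iota y.
Proof. by have [] := C_completion. Qed.

Lemma iota_odot a x : iota (odot a x) = a *: iota x.
Proof. by have [] := C_completion. Qed.

Lemma iota0 : iota 0 = 0.
Proof.
by have := iota_odot 0 0; rewrite /odot spow0 scaler0 scale0r.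
Qed.

Lemma iota_norm x : `|iota x| = conc_norm e x.
Proof. by have [] := C_completion. Qed.

Lemma iota_norm_le x : `|iota x| <= `|x| ^+ 2.
Proof. by rewrite iota_norm; exact: conc_norm_le. Qed.

Lemma iota_ge0 x : vle 0 x -> vle 0 (iota x).
Proof.
have [_ _ iotaL _ _] := C_completion.
by move=> /(lattice_morphism_monotone iotaL); rewrite iota0.
Qed.

Definition geom_mean x y : E :=
  vec e (fun i => spow (coord e x i * coord e y i) 2^-1).

(** The inequality of arithmetic and geometric means. It yields both the convergence of [geom_mean]
    and its norm bound. *)
Lemma geom_mean_le x y i : `|spow (coord e x i * coord e y i) 2^-1| <=
  coord e (2^-1 *: (vabs x + vabs y)) i.
Proof.
rewrite (coordZ e_basis) (coordD e_basis) !(coord_abs e_basis).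
apply: spow_sqrt_le; first by rewrite mulr_ge0 ?addr_ge0 ?invr_ge0.
rewrite normrM; set a := `|_|; set b := `|_|.
have : 0 <= (a - b) ^+ 2 by rewrite sqr_ge0.
by rewrite !expr2 => ?; lra.
Qed.

Lemma coord_geom_mean x y i :
  coord e (geom_mean x y) i = spow (coord e x i * coord e y i) 2^-1.
Proof. by rewrite (coord_vec e_basis (geom_mean_le x y)). Qed.

Lemma geom_mean_norm x y : `|x| <= 1 -> `|y| <= 1 -> `|geom_mean x y| <= 1.
Proof.
move=> x1 y1; apply: (@le_trans _ _ `|2^-1 *: (vabs x + vabs y)|).
  apply: (norm_coord_le e_basis) => i; rewrite coord_geom_mean.
  exact: le_trans (geom_mean_le x y i) (ler_norm _).
rewrite normrZ ger0_norm ?invr_ge0//.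
by have := ler_normD (vabs x) (vabs y); rewrite !vnorm_abs; lra.
Qed.

Lemma geom_mean_disjoint x y : vdisjoint x y -> geom_mean x y = 0.
Proof.
move=> /(congr1 (fun z => coord e z)) /funeqP xy.
apply: (coord_inj e_basis) => i; rewrite coord_geom_mean (coord0 e_basis).
have := xy i; rewrite (coord_meet e_basis) (coord0 e_basis) !(coord_abs e_basis).
case: leP => _ /eqP; rewrite normr_eq0 => /eqP ->; by rewrite ?mul0r ?mulr0 spow0.
Qed.

(** After squaring coordinates, [oplus] and [odot] become ordinary sum and scaling, and the
    geometric mean becomes the product of coordinates. *)
Lemma iota_geom_mean_bilinear :
  bilinear_for *:%R *:%R (fun x y => iota (geom_mean x y)).
Proof.
split=> z c x y /=; rewrite -iota_odot -iota_oplus; congr iota;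
  apply: (coord_inj e_basis) => i;
  rewrite (coord_oplus e_basis) (coordZ e_basis) !coord_geom_mean;
  rewrite (coord_linear e_basis) -!spowM !spow_sqrtK; congr spow; ring.
Qed.

(** Shows that every [iota x] is the image of a single elementary tensor, which gives the dense
    range. *)
Lemma geom_mean_self x : geom_mean x (vabs x) = x.
Proof.
apply: (coord_inj e_basis) => i; rewrite coord_geom_mean (coord_abs e_basis).
by rewrite -spow2E spow_sqrK.
Qed.

Lemma geom_mean_basis i : geom_mean (e i) (e i) = e i.
Proof. by rewrite -[RHS]geom_mean_self vabs_pos//; exact: basis_ge0. Qed.

Definition iota_geom_mean : {bilinear E -> E -> C} :=
  HB.pack (fun x y => iota (geom_mean x y))
    (bilinear_isBilinear.Build R E E C *:%R *:%R
      (fun x y => iota (geom_mean x y)) iota_geom_mean_bilinear).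

Lemma iota_psum (u : nat -> R) N :
  \sum_(i < N) u i *: iota (e i) = iota (psum e (fun i => spow (u i) 2^-1) N).
Proof.
(* Pairing with the truncated constant sequence 1 writes the vector as a geometric mean that is
   linear in [u]. *)
have -> : psum e (fun i => spow (u i) 2^-1) N =
    geom_mean (psum e u N) (psum e (fun=> 1) N).
  apply: (coord_inj e_basis) => i.
  rewrite coord_geom_mean !(coord_psum e_basis).
  by case: ifP => _; rewrite ?mulr1 ?mulr0 ?spow0.
rewrite -[RHS]/(iota_geom_mean _ _) [X in iota_geom_mean X]/psum linear_sumlz.
apply: eq_bigr => i _; rewrite linearZl_LR; congr (_ *: iota _).
apply: (coord_inj e_basis) => j.
rewrite coord_geom_mean (coord_psum e_basis) (coord_basis e_basis).
have [<-|_] := eqVneq (i : nat) j; last by rewrite mul0r spow0.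
by rewrite ltn_ord mulr1 spow1.
Qed.

(** A truncation and its remainder have disjoint supports, so their [oplus] is their ordinary sum
    [x]. Hence the difference in [C] is [iota] of the remainder. *)
Lemma iota_psum_dist x N :
  `|iota x - iota (psum e (coord e x) N)| <= `|x - psum e (coord e x) N| ^+ 2.
Proof.
set xN := psum _ _ _; have {1}-> : x = oplus e xN (x - xN).
  apply: (coord_inj e_basis) => i; rewrite (coord_oplus e_basis) (coordB e_basis).
  rewrite (coord_psum e_basis); case: ifP => _.
    by rewrite subrr spow0 addr0 spow_sqrK.
  by rewrite subr0 spow0 add0r spow_sqrK.
by rewrite iota_oplus addrAC subrr add0r; exact: iota_norm_le.
Qed.

Lemma iota_psum_cvgn x : (fun N => iota (psum e (coord e x) N)) @ \oo --> iota x.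
Proof.
apply/cvgn_distP => eps e0.
(* A remainder of norm below 1 has square at most itself. *)
have [N hN] := psum_tail_cvg0 e_basis x (eps := Num.min eps 1)
  ltac:(by rewrite lt_min e0 ltr01).
exists N => n /hN; rewrite lt_min => /andP[h1 h2].
apply: le_lt_trans (iota_psum_dist x n) _; apply: le_lt_trans h1.
by rewrite expr2 ler_piMl// ltW.
Qed.

Variables (T : banachLatticeType R) (tens : {bilinear E -> E -> T}).
Hypothesis T_tensor : is_fremlin_tensor tens.

Lemma square_map_exists : exists f : {linear T -> C},
  [/\ forall x y, f (tens x y) = iota (geom_mean x y), forall t, `|f t| <= `|t|
    & forall t, vle 0 t -> vle 0 (f t)].
Proof.
apply: (tensor_extension T_tensor (phi := iota_geom_mean)).
  move=> x y /(vle0_coord e_basis) x0 /(vle0_coord e_basis) y0.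
  apply: iota_ge0; apply/(vle0_coord e_basis) => i; rewrite coord_geom_mean.
  by apply: spow_ge0; exact: mulr_ge0.
move=> x y x1 y1; apply: le_trans (iota_norm_le _) _.
by rewrite exprn_ile1//; exact: geom_mean_norm.
Qed.

Definition square_map : {linear T -> C} := projT1 (cid square_map_exists).

Lemma square_map_tens x y : square_map (tens x y) = iota (geom_mean x y).
Proof. by rewrite /square_map; case: cid => f []. Qed.

Lemma square_map_norm t : `|square_map t| <= `|t|.
Proof. by rewrite /square_map; case: cid => f []. Qed.

Lemma square_map_ge0 t : vle 0 t -> vle 0 (square_map t).
Proof. by rewrite /square_map; case: cid => f [] /= _ _; apply. Qed.

Lemma square_map_diag_sum u N : square_map (diag_sum e tens u N) =
  iota (psum e (fun i => spow (u i) 2^-1) N).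
Proof.
rewrite -iota_psum /diag_sum linear_sum; apply: eq_bigr => i _.
by rewrite linearZ square_map_tens geom_mean_basis.
Qed.

Lemma diag_sum_norm_le u N :
  `|diag_sum e tens u N| <= `|square_map (diag_sum e tens u N)|.
Proof.
rewrite square_map_diag_sum iota_norm; apply: (conc_norm_ge e_basis) => s s0 us.
have u_le i : (i < N)%N -> `|u i| <= \sum_(v <- s) coord e v i ^+ 2.
  by move=> iN; have := us i; rewrite (coord_psum e_basis) iN spow_sqrtK.
have g0 i : vle 0 (tens (e i) (e i)).
  by apply: (tens_ge0 T_tensor); exact: basis_ge0.
apply: (@le_trans _ _ `|\sum_(v <- s) tens v v|); last first.
  apply: le_trans (ler_norm_sum _ _ _) _; apply: ler_sum => v _.
  by rewrite expr2; exact: tens_norm.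
apply: vnorm_le_abs; apply: vle_trans (vabs_sum _ _ _) _.
apply: (@vle_trans _ _ (\sum_(i < N) \sum_(v <- s)
    (coord e v i * coord e v i) *: tens (e i) (e i))).
  apply: vle_sum => i _; apply: vle_trans (vabsZ_le _ _) _.
  rewrite (vabs_pos (g0 i)) -scaler_suml; apply: vle_scalel => //.
  exact: u_le.
(* After the exchange, the inner sum for each [v] is the truncated diagonal of [tens v v]. *)
rewrite exchange_big /= !big_seq; apply: vle_sum => v /s0 v0.
exact: (diag_sum_le_tens e_basis T_tensor _ v0 v0).
Qed.

End Concavification.

(** * Diagonal projection, kernel and range of the induced map *)

Section Diagonal.
Variables (R : realType) (E : banachLatticeType R) (e : nat -> E).
Hypothesis e_basis : lattice_basis e.
Variables (C : banachLatticeType R) (iota : E -> C).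
Hypothesis C_completion : is_conc_completion e iota.
Variables (T : banachLatticeType R) (tens : {bilinear E -> E -> T}).
Hypothesis T_tensor : is_fremlin_tensor tens.

Let Phi : {linear T -> C} := square_map e_basis C_completion T_tensor.
Let coef i : {linear T -> R^o} := diag_coef e_basis T_tensor i.
Let D N t : T := diag_part e_basis T_tensor N t.

Lemma square_map_diag_part_tens x y N :
  Phi (D N (tens x y)) = iota (psum e (coord e (geom_mean e x y)) N).
Proof.
rewrite /D diag_part_tens square_map_diag_sum; congr (iota (psum _ _ _)).
by apply/funext => i; rewrite (coord_geom_mean e_basis).
Qed.

Lemma square_map_diag_part_cvgn t : (fun N => Phi (D N t)) @ \oo --> Phi t.
Proof.
move: t; apply: (tensor_ind T_tensor
  (A := [set t | (fun N => Phi (D N t)) @ \oo --> Phi t])).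
- rewrite /= linear0; apply/cvgn_distP => eps e0; exists 0%N => n _.
  by rewrite /D diag_part0 linear0 subrr normr0.
- move=> s t /= hs ht; rewrite linearD.
  have -> : (fun N => Phi (D N (s + t))) = (fun N => Phi (D N s) + Phi (D N t)).
    by apply/funext => N; rewrite /D diag_partD linearD.
  exact: (@cvgD _ C).
- move=> x y /=; rewrite square_map_tens.
  have -> : (fun N => Phi (D N (tens x y))) =
      (fun N => iota (psum e (coord e (geom_mean e x y)) N)).
    by apply/funext => N; rewrite square_map_diag_part_tens.
  exact: (iota_psum_cvgn e_basis C_completion).
(* The maps [Phi] after [D N] are contractions uniformly in [N], so convergence passes to limits by
   an argument with three thirds of [eps]. *)
- move=> t /closure_normP clt; apply/cvgn_distP => eps e0.
  have [s /cvgn_distP hs ts] := clt (eps / 3) ltac:(lra).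
  have [N hN] := hs (eps / 3) ltac:(lra).
  exists N => n /hN hn.
  have -> : Phi t - Phi (D n t) =
      Phi (t - s) + (Phi s - Phi (D n s)) - Phi (D n (t - s)).
    by rewrite /D diag_partB !(linearB Phi) addrA subrK opprB addrA subrK.
  have h1 : `|Phi (t - s)| <= `|t - s| by exact: square_map_norm.
  have h2 : `|Phi (D n (t - s))| <= `|t - s|.
    by apply: le_trans (square_map_norm _ _ _ _) _; exact: diag_part_norm.
  apply: le_lt_trans (ler_normB _ _) _.
  have := ler_normD (Phi (t - s)) (Phi s - Phi (D n s)); lra.
Qed.

Local Arguments square_map_diag_part_cvgn : clear implicits.

(** The difference of two truncations is again a diagonal sum, with the first [m] coefficients set
    to 0, so [diag_sum_norm_le] applies. *)
Lemma diag_part_dist m n t : (m <= n)%N ->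
  `|D n t - D m t| <= `|Phi (D n t) - Phi (D m t)|.
Proof.
move=> mn; rewrite -linearB.
have -> : D n t - D m t =
    diag_sum e tens (fun i => if (i < m)%N then 0 else coef i t) n.
  rewrite /D /diag_part /diag_sum.
  rewrite (big_ord_widen n (fun i => coef i t *: tens (e i) (e i)) mn).
  rewrite [X in _ - X]big_mkcond -sumrB; apply: eq_bigr => i _.
  by case: ifP => _; rewrite ?subrr ?scale0r ?subr0.
exact: diag_sum_norm_le.
Qed.

Lemma diag_proj_exists : exists P : {linear T -> T},
  [/\ forall t, (fun N => D N t) @ \oo --> P t, forall t, Phi (P t) = Phi t
    & forall t, `|P t| <= `|Phi t|].
Proof.
(* The images under [Phi] converge, and [diag_part_dist] pulls the Cauchy property back to [T]. *)
have cvgD_ t : exists s : T, (fun N => D N t) @ \oo --> s.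
  apply: cauchy_seq_cvgn => eps e0.
  have /cvgn_distP ht := square_map_diag_part_cvgn t.
  have [N hN] := ht (eps / 4) ltac:(lra).
  have tail n : (N <= n)%N -> `|D n t - D N t| < eps / 2.
    move=> Nn; apply: le_lt_trans (diag_part_dist t Nn) _.
    rewrite -(subrK (Phi t) (Phi (D n t))) -addrA.
    apply: le_lt_trans (ler_normD _ _) _; rewrite distrC.
    by have := hN n Nn; have := hN N (leqnn N); lra.
  exists N => m n Nm Nn; rewrite -(subrK (D N t) (D m t)) -addrA.
  apply: le_lt_trans (ler_normD _ _) _; rewrite [X in _ + X]distrC.
  by have := tail m Nm; have := tail n Nn; lra.
have [p pP] := choice cvgD_.
have plin : linear p.
  move=> c s t; apply: cvgn_unique (pP _) _.
  have -> : (fun N => D N (c *: s + t)) = (fun N => c *: D N s + D N t).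
    by apply/funext => N; exact: diag_part_linear.
  by apply: (@cvgD _ T) => //; exact: (@cvgZr _ T).
pose pL := GRing.isLinear.Build R T T _ p plin.
pose P : {linear T -> T} := HB.pack p pL.
have PhiP t : Phi (P t) = Phi t.
  apply: cvgn_unique _ (square_map_diag_part_cvgn t).
  exact: (contraction_cvgn (square_map_norm _ _ _) (pP t)).
exists P; split=> // t; rewrite -PhiP; apply/ler_addgt0Pr => eps e0.
have /cvgn_distP ht := square_map_diag_part_cvgn t.
have /cvgn_distP hp := pP t.
have [N hN] := hp (eps / 2) ltac:(lra).
have [M hM] := ht (eps / 2) ltac:(lra).
have h1 := hN (maxn N M) (leq_maxl _ _); have h2 := hM (maxn N M) (leq_maxr _ _).
set n := maxn _ _ in h1 h2.
have h3 : `|D n t| <= `|Phi (D n t)| by exact: diag_sum_norm_le.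
have := ler_normD (p t - D n t) (D n t); rewrite subrK => h4.
have := ler_normD (Phi (D n t) - Phi t) (Phi t); rewrite subrK distrC => h5.
rewrite PhiP /=; lra.
Qed.

Lemma square_map_lattice_morphism : lattice_morphism Phi.
Proof.
apply: linear_lattice_morphism => s t st.
have s0 : vle 0 s by rewrite -st vle_meetl.
have t0 : vle 0 t by rewrite -st vle_meetr.
have g0 i : vle 0 (tens (e i) (e i)).
  by apply: (tens_ge0 T_tensor); exact: basis_ge0.
have coef_le i r : vle 0 r -> vle (coef i r *: tens (e i) (e i)) r.
  move=> r0; apply: vle_trans (diag_part_le e_basis T_tensor i.+1 r0).
  rewrite /diag_part /diag_sum big_ord_recr/= -vle_sub_ge0 addrK.
  by apply: vle0_sum => j _; apply: vle_scale => //; exact: diag_coef_ge0.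
(* The smaller coefficient times [tens (e i) (e i)] lies below both [s] and [t], hence below their
   meet 0; applying [coef i] makes it nonpositive. *)
have coef_meet i : Num.min (coef i s) (coef i t) = 0.
  apply/eqP; rewrite eq_le le_min !diag_coef_ge0// andbT.
  set m := Num.min _ _.
  have : vle (m *: tens (e i) (e i)) 0.
    rewrite -st vle_meetP; apply/andP; split.
      by apply: vle_trans (coef_le i s s0); apply: vle_scalel; rewrite ?ge_min ?lexx.
    apply: vle_trans (coef_le i t t0); apply: vle_scalel; rewrite // ge_min lexx.
    by rewrite orbT.
  rewrite -vleN oppr0 -scaleNr => /(diag_coef_ge0 e_basis T_tensor i).
  by rewrite linearZ diag_coef_tens (coord_basis e_basis) eqxx /= /GRing.scale /=;
    lra.
have [_ _ [_ iotaM] _ _] := C_completion.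
(* [iota] preserves meets, so this is a coordinatewise claim: at each index one of the two
   coefficients is 0. *)
have meet0 N : vmeet (Phi (D N s)) (Phi (D N t)) = 0.
  rewrite /D /diag_part !square_map_diag_sum -iotaM -[RHS](iota0 C_completion).
  congr iota; apply: (coord_inj e_basis) => i.
  rewrite (coord_meet e_basis) !(coord_psum e_basis) (coord0 e_basis).
  case: ifP => _; last by rewrite minxx.
  have := coef_meet i; have hs := diag_coef_ge0 e_basis T_tensor i s0.
  have ht := diag_coef_ge0 e_basis T_tensor i t0.
  case: leP => _ -> ; rewrite spow0.
    by apply: min_l; exact: spow_ge0.
  by apply: min_r; exact: spow_ge0.
have := vmeet_cvgn (square_map_diag_part_cvgn s) (square_map_diag_part_cvgn t).
under eq_fun do rewrite meet0.
by move=> h; apply: cvgn_unique h _; exact: cvg_cst.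
Qed.

Lemma I_oc_ker t : I_oc tens t <-> Phi t = 0.
Proof.
have [PhiJ PhiM] := square_map_lattice_morphism.
split=> [|Phit0 I [[[I0 ID IZ Iideal] Icl] Iperp]].
  (* The kernel of [Phi] is itself a closed order ideal containing the tensors of disjoint pairs, so
     it contains the smallest one. *)
  move=> /(_ [set t | Phi t = 0]); apply; split; last first.
    move=> _ [x [y [xy ->]]]; rewrite /= square_map_tens.
    by rewrite (geom_mean_disjoint e_basis xy) (iota0 C_completion).
  split; last first.
    move=> s cls; apply/eqP; rewrite -normr_le0; apply/ler_addgt0Pr => eps e0.
    have [r r0 sr] := (closure_normP _ _).1 cls eps e0.
    rewrite add0r -[Phi s]subr0 -r0 -linearB.
    exact: le_trans (square_map_norm _ _ _ _) (ltW sr).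
  split=> /= [|x y hx hy|a x hx|x y hy xy].
  - exact: linear0.
  - by rewrite linearD hx hy addr0.
  - by rewrite linearZ hx /= scaler0.
  - have Phi_abs z : Phi (vabs z) = vabs (Phi z) by rewrite PhiJ linearN.
    apply/eqP; rewrite -normr_le0.
    have -> : 0 = `|Phi (vabs y)| by rewrite Phi_abs hy vabs_pos ?normr0 ?vle_refl.
    rewrite -[leLHS]vnorm_abs -Phi_abs; apply: vnorm_le_pos.
      exact/square_map_ge0/vabs_ge0.
    exact: lattice_morphism_monotone square_map_lattice_morphism xy.
have [P [DP PhiP Ple]] := diag_proj_exists.
have P0 s : Phi s = 0 -> P s = 0.
  by move=> s0; apply/eqP; rewrite -normr_le0 (le_trans (Ple _))// s0 normr0.
(* On the kernel [P] vanishes, so it suffices to place [t - P t] in [I] for arbitrary [t], which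
   density reduces to elementary tensors. *)
suff : I (t - P t) by rewrite P0// subr0.
have Isum (J : Type) (r : seq J) (Q : pred J) (f : J -> T) :
    (forall j, Q j -> I (f j)) -> I (\sum_(j <- r | Q j) f j).
  by move=> If; apply: big_ind.
move: t {Phit0}; apply: (tensor_ind T_tensor (A := [set t | I (t - P t)])).
- by rewrite /= linear0 subr0.
- by move=> s t Is It; rewrite /= linearD opprD addrACA; exact: ID.
- move=> x y /=; apply: Icl; apply/closure_normP => eps e0.
  have /cvgn_distP hx := @tens_psum_cvgn _ _ _ e_basis _ _ T_tensor x y.
  have /cvgn_distP hP := DP (tens x y).
  have [N hN] := hx (eps / 2) ltac:(lra).
  have [M hM] := hP (eps / 2) ltac:(lra).
  set n := maxn N M; have := hN n (leq_maxl _ _); have := hM n (leq_maxr _ _).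
  rewrite /D diag_part_tens tens_psum.
  (* The off-diagonal part [o] lies in [I], since distinct basis vectors are disjoint, and it
     approximates [x (x) y - P (x (x) y)]. *)
  set d := diag_sum _ _ _ _; set o := \sum_(i < n) _ => h1 h2; exists o.
    apply: (Isum) => i _; apply: (Isum) => j ji; apply: IZ; apply: Iperp.
    exists (e i), (e j); split=> //; apply: (coord_inj e_basis) => k.
    rewrite (coord_meet e_basis) !(coord_abs e_basis) !(coord_basis e_basis).
    rewrite (coord0 e_basis).
    case: (eqVneq (i : nat) k) => [ik|_]; case: (eqVneq (j : nat) k) => [jk|_].
    - by move: ji; rewrite -val_eqE/= jk ik eqxx.
    - by rewrite normr0 normr1 min_r.
    - by rewrite normr0 normr1 min_l.
    - by rewrite normr0 minxx.
  set w := tens x y; have -> : w - P w - o = w - (d + o) - (P w - d).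
    by rewrite opprB opprD [RHS]addrA (addrAC w _ d) !addrA addrK addrAC.
  by apply: le_lt_trans (ler_normB _ _) _; lra.
- apply: (@lipschitz_closed_preimage R T T (fun t => t - P t) 2 I) => //.
  move=> s t; have -> : s - P s - (t - P t) = s - t - P (s - t).
    by rewrite (linearB P) !opprD addrACA.
  apply: le_trans (ler_normB _ _) _.
  have : `|P (s - t)| <= `|s - t|.
    by apply: le_trans (Ple _) _; exact: square_map_norm.
  lra.
Qed.

(** Since [P t] is bounded by [Phi t], the assignment of [P t] to [Phi t] extends from the dense
    range to a contraction [S] on [C]. Then [Phi] after [S] is the identity on that range, hence
    everywhere by continuity. *)
Lemma square_map_surjective c : exists t, Phi t = c.
Proof.
have [P [_ PhiP Ple]] := diag_proj_exists.
have [_ _ _ _ iota_dense] := C_completion.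
have Phi_dense : dense (range Phi).
  move=> O O0 Oo; have [d [Od [x _ xd]]] := iota_dense O O0 Oo.
  exists d; split=> //; exists (tens x (vabs x)) => //.
  by rewrite square_map_tens geom_mean_self.
have [i j|a i|i|S SE Sle] := @dense_contraction_extension R C T T Phi P Phi_dense.
- by exists (i + j); rewrite linearD.
- by exists (a *: i); rewrite linearZ.
- exact: Ple.
exists (S c); apply/eqP; rewrite -subr_eq0 -normr_le0; apply/ler_addgt0Pr => eps e0.
have [_ [t _ <-] ct] := dense_normP Phi_dense c (divr_gt0 e0 (ltr0Sn R 1)).
rewrite add0r.
have -> : Phi (S c) - c = Phi (S (c - Phi t)) - (c - Phi t).
  by rewrite (linearB S) (linearB Phi) SE PhiP opprB addrA subrK.
apply: le_trans (ler_normB _ _) _.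
have : `|Phi (S (c - Phi t))| <= `|c - Phi t|.
  by apply: le_trans (square_map_norm _ _ _ _) _; exact: Sle.
by move: ct; lra.
Qed.

End Diagonal.

(** * The isometry on the quotient *)

Lemma series_diag_sum (R : realType) (E T : banachLatticeType R) (e : nat -> E)
    (tens : {bilinear E -> E -> T}) (u : nat -> R) :
  series (fun i => u i *: tens (e i) (e i)) = diag_sum e tens u.
Proof. by apply/funext => N; rewrite /series /= big_mkord. Qed.

Theorem theorem23 (R : realType)
    (E : banachLatticeType R) (e : nat -> E) (e_basis : lattice_basis e)
    (T : banachLatticeType R) (tens : {bilinear E -> E -> T})
    (T_tensor : is_fremlin_tensor tens)
    (Q : banachLatticeType R) (q : {linear T -> Q})
    (Q_quotient : is_lattice_quotient (I_oc tens) q)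
    (C : banachLatticeType R) (iota : E -> C)
    (C_completion : is_conc_completion e iota) :
  (* every coset has exactly one representative \sum_i u_i e_i (x) e_i *)
  (forall w : Q, exists! u : nat -> R, exists t : T,
     series (fun i => u i *: tens (e i) (e i)) @ \oo --> t /\ q t = w) /\
  (exists J : {linear Q -> C},
     [/\ forall (u : nat -> R) (t : T),
           series (fun i => u i *: tens (e i) (e i)) @ \oo --> t ->
           series (fun i => iota (odot (u i) (e i))) @ \oo --> J (q t),
         lattice_isometry J
       & range J = [set: C]]).
Proof.
pose Phi : {linear T -> C} := square_map e_basis C_completion T_tensor.
pose coef i : {linear T -> R^o} := diag_coef e_basis T_tensor i.
have [P [DP PhiP Ple]] := diag_proj_exists e_basis C_completion T_tensor.
have kerP t : I_oc tens t <-> Phi t = 0 := I_oc_ker e_basis C_completion T_tensor t.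
have [q_onto q_ker [qJ qM] q_norm] := Q_quotient.
have q_surj w : exists t, q t = w.
  by have [t _ <-] : range q w; [rewrite q_onto|exists t].
have q_eq s t : q s = q t <-> Phi s = Phi t.
  have h : q (s - t) = 0 <-> Phi (s - t) = 0 by rewrite q_ker kerP.
  split=> st; apply/eqP; rewrite -subr_eq0 -linearB; apply/eqP/h;
    by rewrite linearB st subrr.
(* Adding an element of the kernel does not change [Phi t], which bounds the infimum from below. The
   representative [P t] of the coset shows that the bound is attained. *)
have q_Phi_norm t : `|q t| = `|Phi t|.
  rewrite q_norm; apply/eqP; rewrite eq_le; apply/andP; split; last first.
    apply: lb_le_inf; first by exists `|t + 0|, 0 => //; apply/kerP; exact: linear0.
    move=> _ [v /kerP v0 <-]; rewrite -[Phi t]addr0 -v0 -linearD.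
    exact: square_map_norm.
  apply: le_trans (Ple t); apply: ge_inf.
    by exists 0 => _ [v _ <-].
  exists (P t - t); last by rewrite addrC subrK.
  by apply/kerP; rewrite linearB PhiP subrr.
have q_dense : dense (range q) by move=> O [w Ow] _; exists w; rewrite q_onto.
(* The factorization of [Phi] through [q] is obtained as an extension from the range of [q], which
   is all of [Q]. *)
have [i j|c i|i|J JE Jle] := @dense_contraction_extension R Q C T q Phi q_dense.
- by exists (i + j); rewrite linearD.
- by exists (c *: i); rewrite linearZ.
- by rewrite q_Phi_norm.
have coefP i t : coef i (P t) = coef i t.
  apply: (@diag_coef_lim _ _ _ e_basis _ _ T_tensor i (fun i => coef i t)).
  exact: DP.
split.
  (* The diagonal representative of the coset of [t] is [P t]. For uniqueness, equal cosets have
     equal [Phi], hence equal [P], and [P] preserves the diagonal coefficients. *)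
  move=> w; have [t <-] := q_surj w; exists (fun i => coef i t); split.
    exists (P t); rewrite series_diag_sum; split; first exact: DP.
    by apply/q_eq; exact: PhiP.
  move=> u [s []]; rewrite series_diag_sum => us /q_eq st.
  apply/funext => i; rewrite -(diag_coef_lim e_basis T_tensor i us).
  rewrite -[RHS]coefP -[LHS]coefP; congr (coef i _).
  apply/eqP; rewrite eq_sym -subr_eq0 -linearB -normr_le0.
  by apply: le_trans (Ple _) _; rewrite linearB -/Phi st subrr normr0.
exists J; split.
- move=> u t; rewrite series_diag_sum JE => ut.
  have -> : series (fun i => iota (odot (u i) (e i))) =
      Phi \o diag_sum e tens u.
    apply/funext => N; rewrite /= square_map_diag_sum -iota_psum//.
    rewrite /series /= big_mkord; apply: eq_bigr => i _.
    exact: (iota_odot C_completion).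
  exact: (contraction_cvgn (square_map_norm e_basis C_completion T_tensor) ut).
- have [PhiJ PhiM] :=
    square_map_lattice_morphism e_basis C_completion T_tensor.
  split; first split.
  + move=> w z; have [s <-] := q_surj w; have [t <-] := q_surj z.
    by rewrite -qJ !JE; exact: PhiJ.
  + move=> w z; have [s <-] := q_surj w; have [t <-] := q_surj z.
    by rewrite -qM !JE; exact: PhiM.
  + by move=> w; have [t <-] := q_surj w; rewrite JE q_Phi_norm.
- apply/seteqP; split=> // c _.
  have [t <-] := square_map_surjective e_basis C_completion T_tensor c.
  by exists (q t).
Qed.
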